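(* Let $V$ be a finite dimensional real vector space and let $S$ be a finitely generated commutative subsemigroup of $GL(V)$. Let $x\in V$ be a point which has a somewhere dense orbit under $S$, i.e. the closure $\overline{S(x)}$ of $S(x)=\{sx : s\in S\}$ contains a non-empty open subset of $V$. Let $G$ be the Zariski closure of $S$ in $GL(V)$ and let $G^0$ be its connected component of the identity with respect to the Euclidean topology. Then the orbit $G(x)$ is an open subset of $V$, the natural map $G\to G(x)$, $g\mapsto gx$, is a diffeomorphism, and the closure $\overline{S}$ of $S$ (in $G$) is a subgroup of $G$ which contains $G^0$. *)

(* Defs.v *)
From HB Require Import structures.
From mathcomp Require Import all_boot all_order all_algebra.
From mathcomp Require Import all_classical all_reals all_analysis.
From mathcomp Require mpoly.
Set Implicit Arguments. Unset Strict Implicit. Unset Printing Implicit Defensive.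
Import Order.TTheory GRing.Theory Num.Theory.
Import numFieldNormedType.Exports.
Local Open Scope classical_set_scope.
Local Open Scope ring_scope.

Definition semigroup_gen {R : realType} {n k : nat} (gens : 'I_k -> 'M[R]_n)
  : set 'M[R]_n :=
  [set g | exists2 s : seq 'I_k, s != [::] &
           g = foldr (fun i m => gens i *m m) 1%:M s].

(* Regular functions on the affine variety GL_n : elements of
   R[x_ij][1/det], i.e. q(entries)/det^k with q a polynomial. *)
Definition regular_fun {R : realType} {n : nat} (f : 'M[R]_n -> R) : Prop :=
  exists (q : mpoly.mpoly (n * n) R) (k : nat),
    forall g : 'M[R]_n, g \in unitmx ->
      f g = mpoly.meval (fun i => mxvec g 0 i) q / (\det g) ^+ k.

Definition zariski_closure_GL {R : realType} {n : nat} (A : set 'M[R]_n)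
  : set 'M[R]_n :=
  [set g | g \in unitmx /\
     forall f : 'M[R]_n -> R, regular_fun f ->
       (forall a, A a -> f a = 0) -> f g = 0].

Definition closure_in {R : realType} {n : nat} (G A : set 'M[R]_n) : set 'M[R]_n :=
  closure A `&` G.

Fixpoint Ck_on {R : realType} {V W : normedModType R} (k : nat)
  (U : set V) (f : V -> W) : Prop :=
  match k with
  | 0 => {in U, continuous f}
  | k'.+1 => (forall x, U x -> differentiable f x) /\
             forall v : V, Ck_on k' U ('D_v f)
  end.

Definition smooth_on {R : realType} {V W : normedModType R}
  (U : set V) (f : V -> W) : Prop := forall k, Ck_on k U f.

(* Main.v *)
Require Import Defs.
From HB Require Import structures.
From mathcomp Require Import all_boot all_order all_algebra.
From mathcomp Require Import complex ring.
From mathcomp Require Import all_classical all_reals all_analysis.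
From mathcomp Require mpoly.
Set Implicit Arguments.
Unset Strict Implicit.
Unset Printing Implicit Defensive.
Import Order.TTheory GRing.Theory Num.Theory.
Import numFieldNormedType.Exports.
(* mpoly's notations clash with those of the analysis library. *)
Import (canonicals, coercions) mpoly.
Local Open Scope classical_set_scope.
Local Open Scope ring_scope.

(* Since S x spans V, evaluation at x is injective on the centralizer of S and
   has a linear inverse L. A polynomial vanishing on S vanishes on the open set
   L(U), hence on the whole space L(V), so G is the group of invertible elements
   of the centralizer, its orbit is { v | det (L v) <> 0 }, and L inverts the
   orbit map.

   Choose a set I of generators, minimal such that the monoid M_I they generate
   has a somewhere dense orbit, say dense in U. As M_I is the union of M_(I - i)
   and s_i M_I, minimality gives inductively that q M_I x is dense in U for
   every q in M_I. Taking q = h p with h x in U shows that p^-1 is in the closure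
   of M_I, which is therefore an open and closed subgroup of G and contains
   G0. Finally, b^2 is in G0 for every b in G, as b^2 can be joined to a scalar
   by ((1 - t) b + t z) ((1 - t) b + t z^* ) for a suitable complex z = r + i;
   so the closure of S contains s_j (s_j^2)^-1 = s_j^-1 for every generator. *)

(** * Continuity of matrix operations *)

Lemma closure_image {X Y : topologicalType} (f : X -> Y) (A : set X) (y : X) :
  {for y, continuous f} -> closure A y -> closure (f @` A) (f y).
Proof.
move=> fy Ay B /fy /Ay [a [Aa Ba]]; exists (f a); split => //; by exists a.
Qed.

Section MatrixContinuity.
Context {R : realType}.

Lemma cvg_mx {T} {F : set_system T} {FF : Filter F} m n
    (f : T -> 'M[R]_(m, n)) (M : 'M[R]_(m, n)) :
  (forall i j, f t i j @[t --> F] --> M i j) -> f t @[t --> F] --> M.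
Proof.
move=> fM A [P MP sPA].
suff : \forall t \near F, forall i j, P i j (f t i j).
  by apply: filterS => t Pt; apply: sPA.
by apply: filter_forall => i; apply: filter_forall => j; apply: fM; apply: MP.
Qed.

Lemma cvg_coord {T} {F : set_system T} {FF : Filter F} m n
    (f : T -> 'M[R]_(m, n)) (M : 'M[R]_(m, n)) i j :
  f t @[t --> F] --> M -> f t i j @[t --> F] --> M i j.
Proof. by move=> fM; exact: cvg_comp fM (@coord_continuous _ _ _ i j M). Qed.

Lemma cvg_mulmx {T} {F : set_system T} {FF : Filter F} m n p
    (f : T -> 'M[R]_(m, n)) (g : T -> 'M[R]_(n, p))
    (A : 'M[R]_(m, n)) (B : 'M[R]_(n, p)) :
  f t @[t --> F] --> A -> g t @[t --> F] --> B ->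
  f t *m g t @[t --> F] --> A *m B.
Proof.
move=> fA gB; apply: cvg_mx => i j; rewrite mxE.
under eq_fun do rewrite mxE.
apply: cvg_big => [|k _]; first exact: add_continuous.
by apply: cvgM; exact: cvg_coord.
Qed.

Lemma continuous_mulmxl m n p (A : 'M[R]_(m, n)) :
  continuous (fun B : 'M[R]_(n, p) => A *m B).
Proof.
move=> B; have BB : X @[X --> B] --> B by exact: cvg_id.
have AA : A @[X --> B] --> A by exact: (@cvg_cst _ A _ (nbhs B) _).
exact: cvg_mulmx AA BB.
Qed.

Lemma continuous_mulmxr m n p (B : 'M[R]_(n, p)) :
  continuous (fun A : 'M[R]_(m, n) => A *m B).
Proof.
move=> A; have AA : X @[X --> A] --> A by exact: cvg_id.
have BB : B @[X --> A] --> B by exact: (@cvg_cst _ B _ (nbhs A) _).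
exact: cvg_mulmx AA BB.
Qed.

Lemma cvg_det {T} {F : set_system T} {FF : Filter F} n
    (f : T -> 'M[R]_n) (A : 'M[R]_n) :
  f t @[t --> F] --> A -> \det (f t) @[t --> F] --> \det A.
Proof.
move=> fA; apply: cvg_big => [|s _]; first exact: add_continuous.
apply: cvgM; first exact: cvg_cst.
by apply: cvg_big => [|i _]; [exact: mul_continuous|exact: cvg_coord].
Qed.

Lemma cvg_adj {T} {F : set_system T} {FF : Filter F} n
    (f : T -> 'M[R]_n) (A : 'M[R]_n) :
  f t @[t --> F] --> A -> \adj (f t) @[t --> F] --> \adj A.
Proof.
move=> fA; apply: cvg_mx => i j; rewrite mxE.
under eq_fun do rewrite mxE.
apply: cvgM; first exact: cvg_cst.
apply: cvg_det; apply: cvg_mx => k l; rewrite !mxE.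
by under eq_fun do rewrite !mxE; exact: cvg_coord.
Qed.

(** Cramer's formula stands in for [invmx], which is defined by cases and agrees with it on
    [unitmx]. *)
Lemma continuous_invmx n (A : 'M[R]_n) :
  A \in unitmx ->
  {for A, continuous (fun B : 'M[R]_n => (\det B)^-1 *: \adj B)}.
Proof.
rewrite unitmxE unitfE => A0.
have AA : B @[B --> A] --> A by exact: cvg_id.
have detVA : (\det B)^-1 @[B --> A] --> (\det A)^-1.
  have detA : \det B @[B --> A] --> \det A by exact: (cvg_det AA).
  exact: (cvgV A0 detA).
have adjA : \adj B @[B --> A] --> \adj A by exact: (cvg_adj AA).
exact: cvgZ detVA adjA.
Qed.

(** Vanishing on an open set can be tested along lines, where it becomes a matter of counting roots
    in one variable. *)
Lemma meval_line N (q : mpoly.mpoly N R) (a b : 'I_N -> R) :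
  exists p : {poly R}, forall t,
    mpoly.meval (fun i => a i + t * b i) q = p.[t].
Proof.
elim/mpoly.mpolyind: q => [|c m q _ _ [p pE]].
  by exists 0 => t; rewrite mpoly.meval0 horner0.
exists (c *: \prod_i ((a i)%:P + b i *: 'X) ^+ m i + p) => t.
rewrite mpoly.mevalD mpoly.mevalZ mpoly.mevalX pE hornerD hornerZ horner_prod.
congr (_ * _ + _); apply: eq_bigr => i _.
by rewrite horner_exp !hornerE mulrC.
Qed.

Lemma cvg_meval {T} {F : set_system T} {FF : Filter F} N
    (q : mpoly.mpoly N R) (f : T -> 'I_N -> R) (a : 'I_N -> R) :
  (forall i, f t i @[t --> F] --> a i) ->
  mpoly.meval (f t) q @[t --> F] --> mpoly.meval a q.
Proof.
move=> fa; elim/mpoly.mpolyind: q => [|c m q _ _ IH].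
  rewrite mpoly.meval0 (_ : (fun t => _) = cst 0); first exact: cvg_cst.
  by apply/funext => t; rewrite mpoly.meval0.
rewrite mpoly.mevalD mpoly.mevalZ mpoly.mevalX.
rewrite (_ : (fun t => _) = fun t =>
    c * \prod_i f t i ^+ m i + mpoly.meval (f t) q).
  apply: cvgD IH; apply: cvgM; first exact: cvg_cst.
  apply: cvg_big => [|i _]; first exact: mul_continuous.
  exact: cvg_comp (fa i) (@exprn_continuous R _ (a i)).
by apply/funext => t; rewrite mpoly.mevalD mpoly.mevalZ mpoly.mevalX.
Qed.

End MatrixContinuity.

(** * Somewhere dense sets *)

Section SomewhereDense.
Context {R : realType}.

Definition somewhere_dense {T : topologicalType} (A : set T) :=
  exists U : set T, [/\ open U, U !=set0 & U `<=` closure A].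

Lemma somewhere_denseS {T : topologicalType} (A B : set T) :
  A `<=` B -> somewhere_dense A -> somewhere_dense B.
Proof.
move=> AB [U [oU U0 UA]]; exists U; split => //.
exact: subset_trans UA (closureS AB).
Qed.

(** The part of [U] outside [closure A] is open and lies in [closure B], so it must be empty. *)
Lemma closureU_not_somewhere_dense {T : topologicalType} (U A B : set T) :
  open U -> U `<=` closure (A `|` B) -> ~ somewhere_dense B ->
  U `<=` closure A.
Proof.
move=> oU UAB nB u Uu; apply: contrapT => nAu; apply: nB.
exists (U `&` ~` closure A); split.
- by apply: openI => //; apply: closed_openC; exact: closed_closure.
- by exists u.
- by move=> v [/UAB]; rewrite closureU => -[].
Qed.

Lemma closure_vanish {T : topologicalType} {W : normedModType R} (f : T -> W)
    (A : set T) (y : T) :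
  (forall a, A a -> f a = 0) -> continuous f -> closure A y -> f y = 0.
Proof.
move=> fA fc Ay; have /closure_id c0 : closed [set (0 : W)].
  by apply: accessible_closed_set1; exact/hausdorff_accessible/norm_hausdorff.
suff : closure [set (0 : W)] (f y) by rewrite -c0.
apply: (@closureS _ (f @` A)); first by move=> _ [a /fA ? <-].
by apply: closure_image Ay; exact: fc.
Qed.

Lemma near_line n (U : set 'cV[R]_n) (w v : 'cV[R]_n) :
  open U -> U w -> \forall t \near (0 : R), U (w + t *: v).
Proof.
move=> oU Uw.
have c : (w + t *: v) @[t --> (0 : R)] --> w + (0 : R) *: v.
  apply: cvgD; first exact: cvg_cst.
  by apply: cvgZr_tmp; exact: cvg_id.
rewrite scale0r addr0 in c.
by apply: c; apply: open_nbhs_nbhs.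
Qed.

(** By continuity [C] vanishes on an open set, and differences of two points of that set have
    arbitrary directions. *)
Lemma somewhere_dense_ker m n (A : set 'cV[R]_n) (C : 'M[R]_(m, n)) :
  somewhere_dense A -> (forall v, A v -> C *m v = 0) -> C = 0.
Proof.
move=> [U [oU [w Uw] UA]] CA.
have clC : forall v, closure A v -> C *m v = 0.
  move=> v Av; apply: (@closure_vanish _ _ (mulmx C) A v CA _ Av).
  exact: continuous_mulmxl.
have C0 (v : 'cV[R]_n) : C *m v = 0.
  have /nbhs_ballP[e /= e0 eU] := near_line v oU Uw.
  have e20 : 0 < e / 2 by rewrite divr_gt0.
  have /UA/clC : U (w + (e / 2) *: v).
    apply: eU; rewrite /ball /= sub0r normrN gtr0_norm //.
    by rewrite ltr_pdivrMr // ltr_pMr // ltr1n.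
  rewrite mulmxDr (clC _ (UA _ Uw)) add0r.
  by rewrite -scalemxAr => /eqP; rewrite scaler_eq0 (gt_eqF e20) => /eqP.
apply/matrixP => i j.
have := congr1 (fun v : 'cV_m => v i 0) (C0 (delta_mx j 0)).
by rewrite -colE !mxE.
Qed.

(** The columns are picked one at a time, each outside the span of the earlier ones, and are stored
    as rows until the end. *)
Lemma unitmx_cols_in n (A : set 'cV[R]_n) :
  somewhere_dense A ->
  exists2 P : 'M[R]_n, P \in unitmx & forall i, A (col i P).
Proof.
move=> dA.
suff : forall k, (k <= n)%N ->
    exists2 M : 'M[R]_(k, n), row_free M & forall i, A (row i M)^T.
  move=> /(_ n (leqnn n))[M Mf AM]; exists M^T.
    by rewrite unitmx_tr -row_free_unit.
  by move=> i; rewrite -tr_row.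
elim=> [_|k IH kn]; first by exists 0; [rewrite -row_leq_rank|case].
have [M Mf AM] := IH (ltnW kn).
(* As [k < n], the cokernel of [M] is nonzero and cannot annihilate all of [A]; a vector that it
   does not annihilate is outside the row space of [M]. *)
have : exists2 v, A v & (cokermx M)^T *m v != 0.
  apply: contrapT => nv; have : (cokermx M)^T = 0.
    apply: somewhere_dense_ker dA _ => v Av; apply/eqP/negPn/negP => Cv.
    by apply: nv; exists v.
  move=> /(congr1 (fun M => \rank M)); rewrite mxrank_tr mxrank_coker mxrank0.
  by move: Mf => /eqP -> /eqP; rewrite subn_eq0 leqNgt kn.
move=> [v Av Cv].
have vM : ~~ (v^T <= M)%MS.
  rewrite submxE; apply: contra Cv => /eqP vM0.
  by rewrite -[v]trmxK -trmx_mul vM0 trmx0.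
exists (col_mx v^T M : 'M[R]_(1 + k, n)).
  have : (M < v^T + M)%MS.
    rewrite ltmxE addsmxSr; apply: contra vM; apply: submx_trans.
    exact: addsmxSl.
  by move=> /rank_ltmx; rewrite (eqP Mf) addsmxE -row_leq_rank.
move=> i; rewrite -(@splitK 1 k i); case: (@fintype.split 1 k i) => j /=.
  by rewrite (@rowKu _ 1 k n j) row_id // trmxK.
by rewrite (@rowKd _ 1 k n j).
Qed.

End SomewhereDense.

(** * A path of invertible matrices *)

Lemma seq_ub {R : realDomainType} (s : seq R) :
  exists r, forall y, y \in s -> y < r.
Proof.
elim: s => [|y s [r rP]]; first by exists 0.
exists (Num.max (y + 1) r) => z; rewrite inE lt_max => /orP[/eqP->|/rP->].
  by rewrite ltrDl ltr01.
by rewrite orbT.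
Qed.

Section SquarePath.
Context {R : rcfType}.
Local Notation C := (complex R).
Local Notation toC := (real_complex R).

(* With r larger than |Re l / Im l| for every eigenvalue l of b, no nonzero real
   multiple of r + i or r - i is an eigenvalue. *)
Lemma unitmx_complex_shift n (b : 'M[R]_n) : b \in unitmx ->
  exists r : R, forall (e t : R), `|e| = 1 -> 0 <= t -> t <= 1 ->
    (toC (1 - t) *: map_mx toC b + (toC t * (Complex r e))%:M) \in unitmx.
Proof.
move=> bU; set A := map_mx toC b.
have AU : A \in unitmx by rewrite map_unitmx.
have [rs rsE] := closed_field_poly_normal (char_poly A).
rewrite (monicP (char_poly_monic A)) scale1r in rsE.
have [r rP] := seq_ub [seq `|complex.Re l / complex.Im l| | l <- rs].
exists r => e t e1 t0 t1; rewrite unitmxE unitfE; apply/negP => /det0P[v v0].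
have e0 : e != 0 by rewrite -normr_eq0 e1 oner_neq0.
rewrite mulmxDr -scalemxAr mul_mx_scalar => /eqP; rewrite addr_eq0 -scaleNr.
have [->|tN1] := eqVneq t 1.
  rewrite subrr rmorph0 scale0r rmorph1 mul1r eq_sym scaler_eq0 (negPf v0) orbF.
  by rewrite oppr_eq0 eq_complex /= (negPf e0) andbF.
have s0 : 1 - t != 0 by rewrite subr_eq0 eq_sym.
(* A kernel vector [v] is an eigenvector of [A] whose eigenvalue [m] is a real multiple of
   [r + i e]. *)
move=> /eqP vE; pose m : C := toC (- (t / (1 - t))) * Complex r e.
have vA : v *m A = m *: v.
  apply: (@scalerI _ _ (toC (1 - t))); first by rewrite fmorph_eq0.
  rewrite vE scalerA; congr (_ *: _); rewrite /m mulrA -rmorphM mulrN mulrCA.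
  by rewrite divff // mulr1 rmorphN mulNr.
have [tz|tn0] := eqVneq t 0.
  move: v0; rewrite -(mulmxK AU v) vA /m tz mul0r oppr0 rmorph0 mul0r scale0r.
  by rewrite mul0mx eqxx.
have : root (char_poly A) m.
  by rewrite -eigenvalue_root_char; apply/eigenvalueP; exists v.
rewrite rsE root_prod_XsubC => mrs.
(* The real and imaginary parts of [m] have ratio [r / e], so the choice of [r] would give
   [|r| < r]. *)
have := rP _ (map_f (fun l => `|complex.Re l / complex.Im l|) mrs).
have q0 : - (t / (1 - t)) != 0 by rewrite oppr_eq0 mulf_neq0 ?invr_eq0.
rewrite /m /= !mul0r subr0 addr0 -mulf_div divff // mul1r normrM normfV e1.
by rewrite invr1 mulr1 ltNge ler_norm.
Qed.

(** The matrix is the product of [(1 - t) b + t z] and its complex conjugate, for [z = r + i], and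
    both factors are invertible. It runs from [b^2] to the scalar [r^2 + 1]. *)
Lemma unitmx_square_path n (b : 'M[R]_n) : b \in unitmx ->
  exists r : R, forall t : R, 0 <= t -> t <= 1 ->
    ((1 - t) ^+ 2 *: (b *m b) + (r *+ 2 * t * (1 - t)) *: b
      + ((r ^+ 2 + 1) * t ^+ 2)%:M) \in unitmx.
Proof.
move=> /unitmx_complex_shift[r rP]; exists r => t t0 t1.
rewrite -(map_unitmx toC).
have /(_ (normr1 _) t0 t1) U1 := rP 1 t.
have /(_ _ t0 t1) U2 := rP (-1) t.
have {U2} U2 := U2 (normrN1 _).
set B := map_mx toC b in U1 U2.
suff -> : map_mx toC ((1 - t) ^+ 2 *: (b *m b) + (r *+ 2 * t * (1 - t)) *: b
      + ((r ^+ 2 + 1) * t ^+ 2)%:M) =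
    (toC (1 - t) *: B + (toC t * Complex r 1)%:M) *m
    (toC (1 - t) *: B + (toC t * Complex r (- 1))%:M).
  by rewrite unitmx_mul U1 U2.
rewrite !map_mxD !map_mxZ map_mxM map_scalar_mx /=.
rewrite mulmxDl !mulmxDr -!scalemxAl -!scalemxAr !mul_scalar_mx !mul_mx_scalar.
rewrite scale_scalar_mx !scalerA -!addrA; congr (_ + _).
  by rewrite -rmorphM -expr2.
rewrite !addrA -scalerDl; congr (_ *: _ + _%:M).
  simpc; apply/eqP; rewrite eq_complex /=.
  by apply/andP; split; apply/eqP; ring.
by simpc; apply/eqP; rewrite eq_complex /=; apply/andP; split; apply/eqP; ring.
Qed.

End SquarePath.

(** * The Zariski closure *)

Section Smooth.
Context {R : realType} {V W : normedModType R}.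

Lemma Ck_on_cst k (U : set V) (c : W) : Ck_on k U (cst c).
Proof.
elim: k c => [|k IH] c /=; first by move=> v _; exact: cst_continuous.
split=> [v _|v]; first exact: differentiable_cst.
rewrite (_ : 'D_v (cst c) = cst 0); first exact: IH.
by apply/funext => y; rewrite derive_cst.
Qed.

Lemma smooth_on_linear (U : set V) (f : {linear V -> W}) :
  continuous f -> smooth_on U f.
Proof.
move=> fc [|k] /=; first by move=> v _; exact: fc.
split=> [v _|v]; first exact: linear_differentiable.
rewrite (_ : 'D_v f = cst (f v)); first exact: Ck_on_cst.
apply/funext => y; rewrite deriveE; last exact: linear_differentiable.
by rewrite diff_lin.
Qed.

End Smooth.

Lemma connected_component_clopen {T : topologicalType} (G H : set T) (a : T) :
  H a -> H `<=` G ->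
  (exists2 O, open O & H = G `&` O) -> (exists2 F, closed F & H = G `&` F) ->
  connected_component G a `<=` H.
Proof.
move=> Ha HG [E oE HE] [F cF HF]; set K := connected_component G a.
have KG : K `<=` G by exact: connected_component_sub.
have KH X : H = G `&` X -> K `&` H = K `&` X.
  by move=> ->; rewrite setIA (setIidl KG).
suff <- : (K `&` H = K); first by move=> y [].
apply: (@component_connected _ G a).
- by exists a; split => //; apply: connected_component_refl; exact: HG.
- by exists E => //; exact: KH.
- by exists F => //; exact: KH.
Qed.

Lemma poly_near0_eq0 {R : realType} (p : {poly R}) :
  (\forall t \near (0 : R), p.[t] = 0) -> p = 0.
Proof.
move=> /nbhs_ballP[e /= e0 pe]; apply/eqP/negPn/negP => p0.
(* These [size p] distinct points are one more than the roots a nonzero [p] can have; the shift by 2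
   keeps them strictly inside the ball of radius [e]. *)
pose rs := [seq e / k.+2%:R | k <- iota 0 (size p)].
have : (size rs < size p)%N.
  apply: max_poly_roots p0 _ _.
    apply/allP => _ /mapP[k _ ->]; apply/eqP/pe; rewrite /ball /= sub0r normrN.
    by rewrite gtr0_norm ?divr_gt0 // ltr_pdivrMr // ltr_pMr // ltr1n.
  rewrite map_inj_uniq ?iota_uniq // => i j.
  by move=> /(mulfI (lt0r_neq0 e0))/invr_inj/eqP; rewrite eqr_nat => /eqP[].
by rewrite size_map size_iota ltnn.
Qed.

(** * The Zariski closure as a centralizer *)

Section ZariskiClosure.
Context {R : realType} {n : nat}.
Implicit Types (S : set 'M[R]_n) (x : 'cV[R]_n) (g : 'M[R]_n).

(** For a commutative set [S] of invertible matrices with a somewhere dense orbit, this is the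
    Zariski closure of [S]. *)
Definition unit_centralizer S : set 'M[R]_n :=
  [set g | g \in unitmx /\ forall s, S s -> g *m s = s *m g].

(** For [s] in a commutative [S] these functions vanish on [S], which places the Zariski closure in
    the centralizer. *)
Lemma regular_fun_commutator s (i j : 'I_n) :
  regular_fun (fun g : 'M[R]_n => (g *m s - s *m g) i j).
Proof.
exists (\sum_k (s k j *: mpoly.mpolyX R (mpoly.mnm1 (mxvec_index i k))
            - s i k *: mpoly.mpolyX R (mpoly.mnm1 (mxvec_index k j)))), 0%N.
move=> g _.
rewrite expr0 divr1 raddf_sum !mxE -sumrN -big_split /=; apply: eq_bigr => k _.
by rewrite mpoly.mevalB !mpoly.mevalZ !mpoly.mevalXU !mxvecE mulrC.
Qed.

(* The columns of an invertible matrix chosen in the orbit give a basis s_i x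
   of V, and L maps the coordinates of v in this basis to the corresponding
   combination of the s_i. *)
Lemma orbit_section S x :
  (forall a b, S a -> S b -> a *m b = b *m a) ->
  somewhere_dense [set s *m x | s in S] ->
  exists L : {linear 'cV[R]_n -> 'M[R]_n},
    [/\ continuous L, forall v, L v *m x = v,
        forall v s, S s -> L v *m s = s *m L v,
        forall v g, (forall s, S s -> g *m s = s *m g) ->
          g *m L v = L v *m g &
        forall g, (forall s, S s -> g *m s = s *m g) -> L (g *m x) = g].
Proof.
move=> Scomm dS; have [P Pu] := unitmx_cols_in dS.
move=> /(_ _)/cid2-/all_sig2[s sS sP].
pose f (v : 'cV[R]_n) := \sum_i (invmx P *m v) i 0 *: s i.
have flin : linear f.
  move=> a u v; rewrite /f scaler_sumr -big_split; apply: eq_bigr => i _ /=.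
  by rewrite mulmxDr -scalemxAr 2!mxE scalerDl scalerA.
have fc : continuous f.
  apply: continuous_big => [|i _ v]; first exact: add_continuous.
  have ci : (invmx P *m u) i 0 @[u --> v] --> (invmx P *m v) i 0.
    exact: cvg_coord (@continuous_mulmxl R _ _ _ (invmx P) v).
  exact: (@cvgZr_tmp R _ _ (nbhs v) _ _ _ (s i) ci).
pose fM := GRing.isLinear.Build _ _ _ _ _ flin.
pose L : {linear 'cV[R]_n -> 'M[R]_n} := HB.pack f fM.
have Lx v : L v *m x = v.
  rewrite /L /= /f mulmx_suml -[RHS](mulKVmx Pu).
  apply/matrixP => i j; rewrite (ord1 j) summxE [RHS]mxE; apply: eq_bigr => k _.
  by rewrite -scalemxAl sP !mxE mulrC.
have LC v g : (forall s, S s -> g *m s = s *m g) -> g *m L v = L v *m g.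
  move=> gC; rewrite /L /= /f mulmx_suml mulmx_sumr; apply: eq_bigr => i _.
  by rewrite -scalemxAl -scalemxAr gC.
have LS v t : S t -> L v *m t = t *m L v.
  by move=> St; rewrite LC // => u Su; exact: Scomm.
exists L; split => //.
(* [L (g *m x) - g] commutes with [S] and kills [x], so it kills the whole orbit and is zero. *)
move=> g gC; apply/eqP; rewrite -subr_eq0; apply/eqP.
apply: (somewhere_dense_ker dS) => _ [t St <-].
rewrite mulmxA mulmxBl LS // gC // -mulmxBr -mulmxA mulmxBl Lx subrr.
by rewrite mulmx0.
Qed.

Lemma zariski_closure_centralizer S x :
  (forall s, S s -> s \in unitmx) ->
  (forall a b, S a -> S b -> a *m b = b *m a) ->
  somewhere_dense [set s *m x | s in S] ->
  zariski_closure_GL S = unit_centralizer S.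
Proof.
move=> SU Scomm dS; apply/seteqP; split=> g [gU gS]; split=> //.
  move=> s Ss; apply/matrixP => i j; apply/eqP; rewrite -subr_eq0; apply/eqP.
  have := gS _ (regular_fun_commutator s i j).
  rewrite !mxE; apply => a Sa.
  by rewrite Scomm // subrr mxE.
move=> f [q [k fE]] fS.
have [L [Lc _ _ _ Lg]] := orbit_section Scomm dS.
pose h (v : 'cV[R]_n) := mpoly.meval (fun i => mxvec (L v) 0 i) q.
have hc : continuous h.
  move=> v; apply: (@cvg_meval _ _ (nbhs v)) => i.
  case/mxvec_indexP: i => i j; rewrite mxvecE.
  rewrite (_ : (fun u => _) = fun u => L u i j).
    exact: cvg_coord (Lc v).
  by apply/funext => u; rewrite mxvecE.
have hS v : [set s *m x | s in S] v -> h v = 0.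
  move=> [s Ss <-]; rewrite /h Lg; last by move=> t St; exact: Scomm.
  have := fS s Ss; rewrite fE ?SU // => /eqP.
  rewrite mulf_eq0 invr_eq0 expf_eq0 => /orP[/eqP //|/andP[_]].
  by have := SU s Ss; rewrite unitmxE unitfE => /negPf->.
suff h0 : h (g *m x) = 0.
  by rewrite fE // -[X in mxvec X](Lg g gS) -/(h _) h0 mul0r.
move: dS => [U [oU [w Uw] UA]].
(* On the line from a point [w] of [U] to [g x], the numerator of [f] pulled back along [L] is a
   polynomial in [t] that vanishes near 0, hence also at [t = 1]. *)
have [p pE] := meval_line q (fun i => mxvec (L w) 0 i)
  (fun i => mxvec (L (g *m x - w)) 0 i).
have hp t : h (w + t *: (g *m x - w)) = p.[t].
  rewrite -pE /h linearD linearZ /=; congr (mpoly.meval _ q).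
  by apply/funext => i; rewrite linearD linearZ !mxE.
have p0 : p = 0.
  apply: poly_near0_eq0; apply: filterS (near_line (g *m x - w) oU Uw) => t Ut.
  rewrite -hp; exact: (closure_vanish hS hc (UA _ Ut)).
by have := hp 1; rewrite p0 horner0 scale1r addrC subrK.
Qed.

End ZariskiClosure.

(** * Closures of monoids *)

Lemma invmxM {R : comUnitRingType} n (a b : 'M[R]_n) :
  a \in unitmx -> b \in unitmx -> invmx (a *m b) = invmx b *m invmx a.
Proof.
move=> aU bU; have abU : a *m b \in unitmx by rewrite unitmx_mul aU bU.
apply: (can_inj (mulKmx abU)).
by rewrite mulmxV // -!mulmxA (mulmxA b) mulmxV // mul1mx mulmxV.
Qed.

Section ClosedSubmonoids.
Context {R : realType} {n : nat}.
Implicit Types (M S : set 'M[R]_n) (a b g : 'M[R]_n).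

Lemma closureM M a b : (forall g h, M g -> M h -> M (g *m h)) ->
  closure M a -> closure M b -> closure M (a *m b).
Proof.
move=> MM Ma Mb.
have lM c : M c -> closure M (c *m b).
  move=> Mc; apply: (@closureS _ ((fun d => c *m d) @` M)).
    by move=> _ [d Md <-]; exact: MM.
  by apply: closure_image Mb; exact: continuous_mulmxl.
have : closure ((fun d => d *m b) @` M) (a *m b).
  by apply: closure_image Ma; exact: continuous_mulmxr.
move=> /(@closureS _ _ (closure M)) clab; apply: closed_closure.
by apply: clab => _ [c /lM ? <-].
Qed.

Lemma closureV M a : (forall g, M g -> g \in unitmx) ->
  (forall g, M g -> closure M (invmx g)) ->
  a \in unitmx -> closure M a -> closure M (invmx a).
Proof.
move=> MU MV aU Ma.
have invE b : b \in unitmx -> invmx b = (\det b)^-1 *: \adj b.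
  by rewrite /invmx => ->.
have := closure_image (continuous_invmx aU) Ma; rewrite -invE //.
move=> /(@closureS _ _ (closure M)) cla; apply: closed_closure.
apply: cla => _ [c Mc <-].
by rewrite -invE ?MU //; exact: MV.
Qed.

Lemma unit_centralizerM S a b :
  unit_centralizer S a -> unit_centralizer S b -> unit_centralizer S (a *m b).
Proof.
move=> [aU aS] [bU bS]; split=> [|s Ss]; first by rewrite unitmx_mul aU bU.
by rewrite -mulmxA bS // !mulmxA aS.
Qed.

Lemma unit_centralizer1 S : unit_centralizer S 1%:M.
Proof. by split=> [|s Ss]; rewrite ?unitmx1 // mul1mx mulmx1. Qed.

Lemma unit_centralizerV S a :
  unit_centralizer S a -> unit_centralizer S (invmx a).
Proof.
move=> [aU aS]; split=> [|s Ss]; first by rewrite unitmx_inv.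
by rewrite -[LHS](mulmxK aU) -(mulmxA _ s a) -aS // mulKmx.
Qed.

Lemma sqr_connected_component S b : unit_centralizer S b ->
  connected_component (unit_centralizer S) 1%:M (b *m b).
Proof.
move=> [bU bS]; have [r rP] := unitmx_square_path bU.
pose q (t : R) := (1 - t) ^+ 2 *: (b *m b) + (r *+ 2 * t * (1 - t)) *: b
      + ((r ^+ 2 + 1) * t ^+ 2)%:M.
(* [d] equals 1 at 0 and [r^2 + 1] at 1, so dividing by it makes the path end at the identity. *)
pose d (t : R) := 1 + (r * t) ^+ 2.
have d0 t : d t != 0 by rewrite gt_eqF // ltr_wpDr ?sqr_ge0 // ltr01.
pose p t := (d t)^-1 *: q t.
have p0 : p 0 = b *m b.
  rewrite /p /d /q subr0 expr1n !(mulr0, mul0r) expr0n /= mulr0 addr0 invr1.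
  by rewrite !scale1r scale0r raddf0 !addr0.
have p1 : p 1 = 1%:M.
  rewrite /p /q subrr expr0n scale0r mulr0 scale0r !add0r scale_scalar_mx.
  have := d0 1; rewrite expr1n mulr1 /d mulr1 => d1.
  by rewrite [_ + 1]addrC mulVf.
have pc : continuous p.
  have cZ (P : {poly R}) (A : 'M[R]_n) : continuous (fun t => P.[t] *: A).
    move=> t.
    exact: (@cvgZr_tmp R _ _ (nbhs t) _ _ _ A (@continuous_horner R P t)).
  have -> : p = fun t => ((1 + (r *: 'X) ^+ 2) : {poly R}).[t]^-1 *:
      (((1 - 'X) ^+ 2 : {poly R}).[t] *: (b *m b)
      + ((r *+ 2) *: 'X * (1 - 'X) : {poly R}).[t] *: b
      + ((r ^+ 2 + 1) *: 'X ^+ 2 : {poly R}).[t] *: 1%:M).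
    by apply/funext => t; rewrite /p /q /d !hornerE scalemx1 -?mulrA.
  move=> t; apply: cvgZ.
    by apply: cvgV; [rewrite !hornerE; exact: d0|exact: continuous_horner].
  by apply: cvgD; [apply: cvgD|]; exact: cZ.
have pconn : connected (p @` `[0, 1]).
  apply: connected_continuous_connected; first exact: segment_connected.
  exact: continuous_subspaceT.
apply: (@connected_component_max _ _ (p @` `[0, 1]) _ _ _ pconn).
- by exists 1 => //=; rewrite in_itv /= ler01 lexx.
- move=> _ [t /= + <-]; rewrite in_itv /= => /andP[t0 t1]; split.
    rewrite unitmxE detZ unitrM unitrX ?unitfE ?invr_eq0 //.
    by rewrite -unitfE -unitmxE rP.
  move=> s Ss.
  have bbS : b *m b *m s = s *m (b *m b).
    by rewrite -mulmxA (bS s Ss) !mulmxA bS.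
  rewrite /p -scalemxAl -scalemxAr /q !mulmxDl !mulmxDr -!scalemxAl -!scalemxAr.
  by rewrite bbS bS // scalar_mxC.
- by exists 0 => //=; rewrite in_itv /= ler01 lexx.
Qed.

End ClosedSubmonoids.

(** * Monoids generated by commuting invertible matrices *)

Section GeneratedMonoid.
Context {R : realType} {n k : nat} (gens : 'I_k -> 'M[R]_n).
Hypothesis gensU : forall i, gens i \in unitmx.
Hypothesis gensC : forall i j, gens i *m gens j = gens j *m gens i.

Definition word (w : seq 'I_k) : 'M[R]_n :=
  foldr (fun i m => gens i *m m) 1%:M w.

(** Unlike in [semigroup_gen], the empty word is allowed; the closures are compared in
    [closure_semigroup_gen]. *)
Definition submonoid (I : {set 'I_k}) : set 'M[R]_n :=
  [set g | exists2 w, all (fun i => i \in I) w & g = word w].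

Lemma word_cat w1 w2 : word (w1 ++ w2) = word w1 *m word w2.
Proof. by elim: w1 => [|i w1 IH] /=; rewrite ?mul1mx // IH mulmxA. Qed.

Lemma word_unit w : word w \in unitmx.
Proof. by elim: w => [|i w IH] /=; rewrite ?unitmx1 // unitmx_mul gensU. Qed.

Lemma gen_word i w : gens i *m word w = word w *m gens i.
Proof.
elim: w => [|j w IH] /=; first by rewrite mulmx1 mul1mx.
by rewrite mulmxA gensC -!mulmxA IH.
Qed.

Lemma submonoidM I g h : submonoid I g -> submonoid I h -> submonoid I (g *m h).
Proof.
move=> [w1 w1I ->] [w2 w2I ->]; exists (w1 ++ w2); last by rewrite word_cat.
by rewrite all_cat w1I.
Qed.

Lemma submonoid1 I : submonoid I 1%:M.
Proof. by exists [::]. Qed.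

Lemma submonoid_gen (I : {set 'I_k}) i : i \in I -> submonoid I (gens i).
Proof. by move=> iI; exists [:: i] => /=; rewrite ?iI // mulmx1. Qed.

Lemma submonoid_unit I g : submonoid I g -> g \in unitmx.
Proof. by move=> [w _ ->]; exact: word_unit. Qed.

Lemma submonoid_centralizer I g :
  submonoid I g -> unit_centralizer (range gens) g.
Proof.
move=> [w _ ->]; split; first exact: word_unit.
by move=> _ [i _ <-]; rewrite gen_word.
Qed.

(** If [i] occurs in a word for [g], commutativity brings that occurrence to the front. *)
Lemma submonoid_split (I : {set 'I_k}) i g : submonoid I g ->
  submonoid (I :\ i) g \/ exists2 h, submonoid I h & g = gens i *m h.
Proof.
move=> [w wI ->]; case: (boolP (i \in w)) => iw.
  right; case/splitPr: iw wI => w1 w2.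
  rewrite all_cat /= => /and3P[w1I _ w2I]; exists (word (w1 ++ w2)).
    by exists (w1 ++ w2) => //; rewrite all_cat w1I.
  by rewrite !word_cat /= !mulmxA gen_word.
left; exists w => //; apply/allP => j jw; rewrite !inE (allP wI) // andbT.
by apply: contraNneq iw => <-.
Qed.

Section MinimalGenerators.
Variables (x : 'cV[R]_n) (I : {set 'I_k}) (U : set 'cV[R]_n).
Hypothesis Imin : forall i, i \in I ->
  ~ somewhere_dense [set g *m x | g in submonoid (I :\ i)].
Hypotheses (oU : open U) (U0 : U !=set0).
Hypothesis UI : U `<=` closure [set g *m x | g in submonoid I].

(* Going from q to q * gens i only discards the translate by q of the orbit of
   the submonoid generated by I :\ i, which is nowhere dense. *)
Lemma dense_translate q : submonoid I q ->
  U `<=` closure [set (q *m g) *m x | g in submonoid I].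
Proof.
move=> [w + ->]; elim/last_ind: w => [_|w i IH].
  apply: subset_trans UI _; apply: closureS => _ [g Ig <-].
  by exists g; rewrite ?mul1mx.
rewrite all_rcons => /andP[iI /IH{}IH].
pose B := [set (word w *m g) *m x | g in submonoid (I :\ i)].
apply: (@closureU_not_somewhere_dense _ _ _ B) => //.
  apply: subset_trans IH _; apply: closureS => _ [g Ig <-].
  have [Ig'|[h Ih ->]] := submonoid_split i Ig; first by right; exists g.
  left; exists h => //.
  by rewrite -cats1 word_cat /= mulmx1 !mulmxA.
(* If [B] were somewhere dense, applying the inverse of [word w] would make the orbit of [x] under
   [submonoid (I :\ i)] somewhere dense, against minimality. *)
move=> [W [oW [v Wv] WB]]; apply: (Imin iI).
exists ((fun v => word w *m v) @^-1` W); split.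
- by move: oW; apply: (proj1 (continuousP _)); exact: continuous_mulmxl.
- by exists (invmx (word w) *m v); rewrite /preimage /= mulKVmx ?word_unit.
- move=> u /WB /(closure_image (@continuous_mulmxl _ _ _ _ (invmx (word w)) _)).
  rewrite mulKmx ?word_unit //; apply: closureS => _ [_ [g Ig <-] <-].
  by exists g => //; rewrite -mulmxA mulKmx ?word_unit.
Qed.

(** For [h x] in [U], density makes [h x] a limit of points [h p g x]; applying the inverse of [h p]
    and then [L] makes the inverse of [p] a limit of the matrices [g]. *)
Lemma submonoid_invmx_closure p (L : 'cV[R]_n -> 'M[R]_n) :
  continuous L ->
  (forall g, unit_centralizer (range gens) g -> L (g *m x) = g) ->
  submonoid I p -> closure (submonoid I) (invmx p).
Proof.
move=> Lc Lg Ip; have [u Uu] := U0.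
have [_ [[h Ih <-] Uh]] : ([set g *m x | g in submonoid I] `&` U) !=set0.
  by apply: (UI Uu); apply: open_nbhs_nbhs.
have hU := submonoid_unit Ih; have pU := submonoid_unit Ip.
have := dense_translate (submonoidM Ih Ip) Uh.
have hpU : h *m p \in unitmx by rewrite unitmx_mul hU pU.
pose f v := L (invmx (h *m p) *m v).
have fc : continuous f.
  move=> v.
  exact: cvg_comp (@continuous_mulmxl R _ _ _ (invmx (h *m p)) v) (Lc _).
have fh : f (h *m x) = invmx p.
  rewrite /f mulmxA.
  have -> : invmx (h *m p) *m h = invmx p.
    by rewrite -[RHS]mul1mx -(mulVmx hpU) -!mulmxA mulmxV // mulmx1.
  by apply: Lg; apply: unit_centralizerV; exact: submonoid_centralizer Ip.
move=> /(closure_image (fc _)); rewrite fh.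
apply: closureS => _ [_ [g Ig <-] <-].
rewrite /f -mulmxA mulKmx // Lg //; exact: submonoid_centralizer Ig.
Qed.

End MinimalGenerators.
End GeneratedMonoid.

(** * The closure of the monoid, the identity component and inverses *)

Section OrbitClosure.
Context {R : realType} {n k : nat} (gens : 'I_k -> 'M[R]_n) (x : 'cV[R]_n).
Variable L : 'cV[R]_n -> 'M[R]_n.
Hypothesis gensU : forall i, gens i \in unitmx.
Hypothesis gensC : forall i j, gens i *m gens j = gens j *m gens i.
Hypothesis Lc : continuous L.
Local Notation G := (unit_centralizer (range gens)).
Hypothesis LG : forall g, G g -> L (g *m x) = g.
Hypothesis dense_orbit :
  somewhere_dense [set g *m x | g in submonoid gens [set: 'I_k]].

Lemma component_sub_closure_submonoid : exists I : {set 'I_k},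
  (forall p, submonoid gens I p -> closure (submonoid gens I) (invmx p)) /\
  connected_component G 1%:M `<=` closure (submonoid gens I).
Proof.
pose P (I : {set 'I_k}) :=
  `[< somewhere_dense [set g *m x | g in submonoid gens I] >].
have [|I /minsetP[/asboolP[U [oU U0 UI]] Imin] _] :=
    @minset_exists _ P [set: 'I_k].
  exact/asboolP.
have {}Imin i : i \in I ->
    ~ somewhere_dense [set g *m x | g in submonoid gens (I :\ i)].
  move=> iI /asboolP Pi; have := Imin _ Pi (subD1set _ _).
  by move=> /setP/(_ i); rewrite iI !inE eqxx.
have MV := submonoid_invmx_closure gensU gensC Imin oU U0 UI Lc LG.
have MG := submonoid_centralizer gensU gensC (I := I).
exists I; split; first by move=> p; exact: MV.
set M := submonoid gens I in UI MV MG *.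
(* [L] turns a limit of points in the orbit of [M] into a limit of elements of [M]. *)
have UL g : G g -> U (g *m x) -> closure M g.
  move=> Gg /UI /(closure_image (@Lc _)); rewrite LG //; apply: closureS.
  by move=> _ [_ [h Mh <-] <-]; rewrite LG //; exact: MG.
have [u Uu] := U0.
have [_ [[m Mm <-] Um]] : ([set g *m x | g in M] `&` U) !=set0.
  by apply: (UI _ Uu); apply: open_nbhs_nbhs.
pose H := closure M `&` G.
suff : connected_component G 1%:M `<=` H by move=> GH g /GH[].
apply: connected_component_clopen.
- split; last exact: unit_centralizer1.
  by apply: subset_closure; exact: submonoid1.
- by move=> g [].
(* Around [h] in [H], take all [g] with [m h^-1 g x] in [U]. For such [g] in [G], [UL] puts
   [m h^-1 g] in [closure M]; the inverse of [m] is there too, hence so is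
   [g = h m^-1 (m h^-1 g)]. *)
- exists (\bigcup_(h in H) [set g | U ((m *m invmx h) *m g *m x)]).
    apply: bigcup_open => h _.
    pose f g := (m *m invmx h) *m g *m x.
    apply: (proj1 (continuousP f) _ _ oU) => g.
    exact: cvg_comp (@continuous_mulmxl R _ _ _ (m *m invmx h) g)
      (@continuous_mulmxr R _ _ _ x (m *m invmx h *m g)).
  apply/seteqP; split=> [h [Mh Gh]|g [Gg [h [Mh Gh] /= Uh]]].
    by split => //; exists h => //=; rewrite mulmxKV //; case: Gh.
  split=> //.
  have mU := submonoid_unit gensU Mm; have hU : h \in unitmx by case: Gh.
  have -> : g = h *m (invmx m *m (m *m invmx h *m g)).
    by rewrite -(mulmxA m) mulKmx // mulKVmx.
  have MM := @submonoidM _ _ _ gens I.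
  apply: closureM => //; apply: closureM => //; first exact: MV.
  apply: UL => //; apply: unit_centralizerM => //; apply: unit_centralizerM.
    exact: MG.
  exact: unit_centralizerV.
- by exists (closure M); [exact: closed_closure|rewrite setIC].
Qed.

(** [gens i] may lie outside the minimal monoid, but its square is in the identity component, hence
    in the closure of that monoid, where inverses are available. *)
Lemma closure_submonoid_gen_invmx i :
  closure (submonoid gens [set: 'I_k]) (invmx (gens i)).
Proof.
have [I [IV IG]] := component_sub_closure_submonoid.
have IT : submonoid gens I `<=` submonoid gens [set: 'I_k].
  by move=> g [w _ ->]; exists w => //; apply/allP => j _; rewrite inE.
have giG : G (gens i).
  apply: (submonoid_centralizer gensU gensC (I := [set: 'I_k]%SET)).
  exact: submonoid_gen.
have -> : invmx (gens i) = gens i *m invmx (gens i *m gens i).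
  have ggU : gens i *m gens i \in unitmx by rewrite unitmx_mul gensU.
  rewrite -[RHS](mulKmx (gensU i)) [X in _ = _ *m X]mulmxA mulmxV ?mulmx1 //.
apply: closureM; first exact: submonoidM.
  by apply: subset_closure; exact: submonoid_gen.
apply: closureS IT _ _; apply: closureV => //.
- exact: submonoid_unit.
- by rewrite unitmx_mul gensU.
- by apply: IG; exact: sqr_connected_component.
Qed.

(** The inverse of a word is a product of inverses of generators, and inversion is continuous at
    [a]. *)
Lemma closure_submonoid_invmx a : a \in unitmx ->
  closure (submonoid gens [set: 'I_k]) a ->
  closure (submonoid gens [set: 'I_k]) (invmx a).
Proof.
apply: closureV => [|_ [w _ ->]]; first exact: submonoid_unit.
elim: w => [|i w IH] /=.
  by rewrite invmx1; apply: subset_closure; exact: submonoid1.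
rewrite invmxM ?gensU ?word_unit //.
apply: closureM => //; first exact: submonoidM.
exact: closure_submonoid_gen_invmx.
Qed.

(** Only the identity has to be recovered: it is [gens i *m invmx (gens i)], a limit of values of
    nonempty words [i :: w]. *)
Lemma closure_semigroup_gen : semigroup_gen gens !=set0 ->
  closure (semigroup_gen gens) = closure (submonoid gens [set: 'I_k]).
Proof.
move=> [_ [[//|i _] _ _]]; apply/seteqP; split.
  apply: closureS => _ [w _ ->]; exists w => //.
  by apply/allP => j _; rewrite inE.
apply: subset_trans (@closed_closure _ (semigroup_gen gens)).
apply: closureS => _ [[|j w] _ ->]; last first.
  by apply: subset_closure; exists (j :: w).
rewrite /= -(mulmxV (gensU i)).
have := closure_image (@continuous_mulmxl _ _ _ _ (gens i) _)
  (@closure_submonoid_gen_invmx i).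
apply: closureS => _ [_ [w _ ->] <-].
by exists (i :: w).
Qed.

End OrbitClosure.

(** * The open orbit, the inverse of the orbit map and the closure of [S] *)

Theorem theorem1p1 (R : realType) (n : nat) (S : set 'M[R]_n) (x : 'cV[R]_n)
  (hGL : forall s, S s -> s \in unitmx)
  (hcomm : forall a b, S a -> S b -> a *m b = b *m a)
  (hfg : exists (k : nat) (gens : 'I_k -> 'M[R]_n), S = semigroup_gen gens)
  (hdense : exists U : set 'cV[R]_n, [/\ open U, U !=set0 &
              U `<=` closure [set s *m x | s in S]]) :
  let G := zariski_closure_GL S in
  let G0 := connected_component G 1%:M in
  let Sbar := closure_in G S in
  [/\ open [set g *m x | g in G],
      (exists phi : 'cV[R]_n -> 'M[R]_n,
         (forall g, G g -> phi (g *m x) = g) /\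
         smooth_on [set g *m x | g in G] phi),
      [/\ Sbar `<=` G, Sbar 1%:M,
          (forall a b, Sbar a -> Sbar b -> Sbar (a *m b)) &
          (forall a, Sbar a -> Sbar (invmx a))]
    & G0 `<=` Sbar].
Proof.
rewrite /closure_in (zariski_closure_centralizer hGL hcomm hdense) /=.
have [L [Lc Lx LS _ Lg]] := orbit_section hcomm hdense.
have LG g : unit_centralizer S g -> L (g *m x) = g by move=> [_ /Lg].
have [k [gens SE]] := hfg.
have gS i : S (gens i) by rewrite SE; exists [:: i]; rewrite //= mulmx1.
have gensU i : gens i \in unitmx by exact: hGL.
have gensC i j : gens i *m gens j = gens j *m gens i by exact: hcomm.
have GE : unit_centralizer S = unit_centralizer (range gens).
  apply/seteqP; split=> g [gU gC]; split=> // s.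
    by move=> [i _ <-]; exact: gC.
  rewrite SE => -[w _ ->]; elim: w => [|i w IH] /=.
    by rewrite mulmx1 mul1mx.
  by rewrite mulmxA gC -?mulmxA ?IH //; exists i.
have LG' g : unit_centralizer (range gens) g -> L (g *m x) = g.
  by rewrite -GE; exact: LG.
have S0 : semigroup_gen gens !=set0.
  have [U [oU [u Uu] US]] := hdense.
  by have [_ [[s Ss _] _]] := US _ Uu _ filterT; exists s; rewrite -SE.
have dM : somewhere_dense [set g *m x | g in submonoid gens [set: 'I_k]].
  apply: somewhere_denseS hdense => _ [s + <-]; rewrite SE => -[w _ ->].
  by exists (word gens w) => //; exists w => //; apply/allP => j _; rewrite inE.
have SM : closure S = closure (submonoid gens [set: 'I_k]).
  by rewrite SE; exact: closure_semigroup_gen gensU gensC Lc LG' dM S0.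
split.
(* [L v] commutes with [S] and sends [x] to [v], so [v] is in the orbit exactly when [\det (L v)] is
   nonzero. *)
- rewrite (_ : [set g *m x | g in _] =
      (fun v => \det (L v)) @^-1` [set t | t != 0]).
    apply: (proj1 (continuousP (fun v => \det (L v))) _ _ (@open_neq R 0)) => v.
    exact: cvg_det (@Lc v).
  apply/seteqP; split=> [_ [g [gU gC] <-]|v /= Lv].
    by rewrite /= Lg // -unitfE -unitmxE.
  exists (L v); last exact: Lx.
  by split=> [|s Ss]; [rewrite unitmxE unitfE|exact: LS].
(* The inverse of the orbit map is the restriction of a linear map. *)
- by exists L; split=> //; exact: smooth_on_linear.
- split=> [g []//||a b [Sa Ga] [Sb Gb]|a [Sa Ga]].
  + split; last exact: unit_centralizer1.
    by rewrite SM; apply: subset_closure; exact: submonoid1.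
  + split; last exact: unit_centralizerM.
    by move: Sa Sb; rewrite SM; apply: closureM; exact: submonoidM.
  + split; last exact: unit_centralizerV.
    move: Sa; rewrite SM.
    by exact: (closure_submonoid_invmx gensU gensC Lc LG' dM (proj1 Ga)).
- have [I [_ IG]] := component_sub_closure_submonoid gensU gensC Lc LG' dM.
  move=> g Gg; split; last exact: connected_component_sub Gg.
  move: Gg; rewrite GE => /IG; rewrite SM; apply: closureS.
  by move=> _ [w _ ->]; exists w => //; apply/allP => j _; rewrite inE.
Qed.
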